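(* $$\int_0^{\infty} e^{-x^2}\,\mathrm{erf}(x)\,dx = \frac{\sqrt{\pi}}{4}.$$
   Context: The error function is $\mathrm{erf}(x)=\frac{2}{\sqrt{\pi}}\int_0^x e^{-t^2}\,dt$. *)

(* Defs.v *)
From mathcomp Require Import all_boot all_order all_algebra.
From mathcomp Require Import all_classical all_reals all_analysis.
Set Implicit Arguments.
Unset Strict Implicit.
Unset Printing Implicit Defensive.
Import Order.TTheory GRing.Theory Num.Theory.
Local Open Scope classical_set_scope.
Local Open Scope ring_scope.

(* Integral of f from a to b with the usual orientation convention:
   the integral from a to b is minus the integral from b to a when b < a. *)
Definition oriented_integral (R : realType) (f : R -> R) (a b : R) : R :=
  if a <= b then (\int[lebesgue_measure]_(t in `[a, b]) f t)%R
  else - (\int[lebesgue_measure]_(t in `[b, a]) f t)%R.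

Definition erf (R : realType) (x : R) : R :=
  2 / Num.sqrt pi * oriented_integral (fun t => expR (- t ^+ 2)) 0 x.

(* Main.v *)
(** With [I x] the integral of [exp (- t^2)] over [[0, x]], the integrand is the
    derivative of [I^2 / sqrt pi] on the positive half-line. So the integral is
    the limit of [I^2 / sqrt pi] at infinity, where [I^2] tends to [pi / 4]. *)
Require Import Defs.
From mathcomp Require Import all_boot all_order all_algebra.
From mathcomp Require Import all_classical all_reals all_analysis.
From mathcomp Require Import ring.
Import Order.TTheory GRing.Theory Num.Theory.
Import numFieldNormedType.Exports.
Import gauss_integral_proof.
Local Open Scope classical_set_scope.
Local Open Scope ring_scope.

(** The sign of [x] selects the unreversed branch of [oriented_integral]. *)
Lemma erfE (R : realType) (x : R) : 0 <= x ->
  erf x = 2 / Num.sqrt pi * integral0_gauss x.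
Proof. by move=> x0; rewrite /erf /oriented_integral x0. Qed.

Lemma integrable_gauss (R : realType) (a b : R) :
  (@lebesgue_measure R).-integrable `[a, b] (EFin \o gauss_fun).
Proof.
apply: continuous_compact_integrable; first exact: segment_compact.
exact/continuous_subspaceT/continuous_gauss_fun.
Qed.

Lemma is_derive_integral0_gauss (R : realType) (x : R) : 0 < x ->
  is_derive x 1 (@integral0_gauss R) (gauss_fun x).
Proof.
(* The bound [x + 1] only serves to make [x] an interior point of the interval of integration. *)
move=> x0; have [dI I'x] := @continuous_FTC1_closed R _ 0 x (x + 1)
  (ltr_pwDr ltr01 (lexx x)) (integrable_gauss _ _ _) x0
  (@continuous_gauss_fun _ x).
by apply: DeriveDef => //; rewrite -derive1E.
Qed.

Lemma integral0_gauss0 (R : realType) : @integral0_gauss R 0 = 0.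
Proof. by rewrite /integral0_gauss set_itv1 Rintegral_set1. Qed.

(** Differentiability is available only for [0 < x], so the endpoint 0 is treated apart: the
    integral is continuous in its upper bound on [[0, 1]]. *)
Lemma integral0_gauss_cvg_at_right0 (R : realType) :
  @integral0_gauss R x @[x --> 0^'+] --> @integral0_gauss R 0.
Proof.
by have /(continuous_within_itvP _ ltr01)[] :=
  parameterized_integral_continuous ler01 (@integrable_gauss R 0 1).
Qed.

Theorem theorem4p7 (R : realType) :
  (\int[@lebesgue_measure R]_(x in `[0%R, +oo[) (expR (- x ^+ 2) * erf x)%:E)%E
  = (Num.sqrt (pi : R) / 4)%:E.
Proof.
pose s : R := Num.sqrt pi.
have s0 : 0 < s by rewrite sqrtr_gt0 pi_gt0.
pose I := @integral0_gauss R.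
pose f : R -> R := fun x => gauss_fun x * (2 / s * I x).
pose F : R -> R := fun x => s^-1 * I x ^+ 2.
have F' (x : R) : 0 < x -> is_derive x 1 F (f x).
  (* The 2 from differentiating the square supplies the factor [2 / s] of [erf]. *)
  move=> /is_derive_integral0_gauss dI; apply: is_derive_eq.
  have scaleE (a b : R) : a *: b = a * b by [].
  by rewrite !scaleE /f /I; ring.
transitivity (\int[@lebesgue_measure R]_(x in `[0%R, +oo[) (f x)%:E)%E.
  apply: eq_integral => x; rewrite inE/= in_itv/= andbT => x0.
  by rewrite erfE.
(* Since [f] is nonnegative, its integral is the limit [s / 4] of [F] at infinity minus [F 0], which
   vanishes. *)
rewrite (@ge0_continuous_FTC2y R f F 0 (s / 4)).
- by rewrite /F /I integral0_gauss0 expr0n mulr0 sube0.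
- move=> x x0; rewrite /f mulr_ge0 ?gauss_fun_ge0// mulr_ge0//.
    by rewrite divr_ge0// ltW.
  exact: integral0_gauss_ge0.
- apply/continuous_within_itvcyP; split => [x|].
    rewrite in_itv/= andbT => /is_derive_integral0_gauss[dI _].
    apply: cvgM; first exact: continuous_gauss_fun.
    by apply: cvgMl_tmp; exact/differentiable_continuous/derivable1_diffP.
  apply: cvgM; first exact/cvg_at_right_filter/continuous_gauss_fun.
  by apply: cvgMl_tmp; exact: integral0_gauss_cvg_at_right0.
(* As [pi = s ^+ 2], this exposes [pi / 4], the limit of [I x ^+ 2] given by the Gaussian
   integral. *)
- have -> : s / 4 = s^-1 * (pi / 4).
    by rewrite -[pi]sqr_sqrtr ?pi_ge0// -/s expr2 !mulrA mulVf ?mul1r// gt_eqF.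
  by apply: cvgMl_tmp; exact: cvg_integral0_gauss_sqr.
- by move=> x /F'[].
- apply: cvgMl_tmp; rewrite expr2.
  by apply: cvgM; exact: integral0_gauss_cvg_at_right0.
- by move=> x; rewrite in_itv/= andbT => /F'[_]; rewrite derive1E.
Qed.
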